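(* Let $T\ge 1$, $L>0$, and let $f_1,\dots,f_T:\mathbb{R}^d\to\mathbb{R}$ be convex and $L$-smooth. Let $f=\frac1T\sum_{t=1}^T f_t$, assume $f$ has a minimizer $x_*\in\arg\min f$, and let $\sigma_*^2:=\frac1T\sum_{t=1}^T\|\nabla f_t(x_* )\|^2<\infty$. Let $\alpha,\beta>0$ satisfy $\frac1\alpha+\frac1\beta\le\frac12$. If the step size of Incremental Gradient Descent is fixed, $\eta_k=\eta$ for all $k$, with $0<\eta\le\frac{1}{\sqrt{\beta}\,TL}$, then the output $x_K$ after $K$ epochs from the initial point $x_0$ satisfies $$f(x_K)-f(x_* )\le \mathrm{e}\,\eta^2T^2\sigma_*^2L\,(1+\beta/\alpha)\,K^{\frac{\alpha/\beta}{1+\alpha/\beta}}+\frac{\mathrm{e}\,\|x_0-x_*\|^2}{2\eta T K^{\frac{1}{1+\alpha/\beta}}}.$$ Moreover, with $\alpha=4$, $\beta=4\log K$, for every $\epsilon>0$ there is a constant step size $\eta$ such that $f(x_K)-f(x_* )\le\epsilon$ after $$TK=\widetilde{\mathcal{O}}\Big(\frac{TL\|x_0-x_*\|^2}{\epsilon}+\frac{TL^{1/2}\sigma_*\|x_0-x_*\|^2}{\epsilon^{3/2}}\Big)$$ individual gradient evaluations.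
   Context: $\|\cdot\|$ is the Euclidean norm on $\mathbb{R}^d$. A differentiable $g$ is $L$-smooth if $\|\nabla g(x)-\nabla g(y)\|\le L\|x-y\|$ for all $x,y$. Incremental Gradient Descent (IGD): given $x_0\in\mathbb{R}^d$, number of epochs $K$, and step sizes $\eta_k>0$; for $k=1,\dots,K$ set $x_{k-1,1}=x_{k-1}$, then for $t=1,\dots,T$ set $x_{k-1,t+1}=x_{k-1,t}-\eta_k\nabla f_t(x_{k-1,t})$, and set $x_k=x_{k-1,T+1}$. The output is $x_K$; each epoch uses $T$ individual gradient evaluations. Convention for the complexity claim: $\widetilde{\mathcal O}(X)$ means at most $C\,X\,(\log(\mathrm{e}+X))^p$ for absolute constants $C,p>0$, and the claim is that there exist an integer $K$ (with $\log K\ge 1$) and a step size $\eta$ (allowed to depend on $K$ and the problem parameters) for which $f(x_K)-f(x_* )\le\epsilon$ and $TK=\widetilde{\mathcal O}(X)$; as usual the bound is read in the regime $X\ge T$ (at least one epoch). *)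

(* Defs.v *)
From HB Require Import structures.
From mathcomp Require Import all_boot all_order all_algebra.
From mathcomp Require Import all_classical all_reals all_analysis.

Set Implicit Arguments.
Unset Strict Implicit.
Unset Printing Implicit Defensive.

Import Order.TTheory GRing.Theory Num.Theory.
Import numFieldNormedType.Exports.

Local Open Scope classical_set_scope.
Local Open Scope ring_scope.

(* The library norm on 'rV[R]_d is the sup norm; it is used below only through
   [differentiable] and ['D_v], which do not depend on the choice of norm. *)
Definition enorm (R : realType) (d : nat) (x : 'rV[R]_d) : R :=
  Num.sqrt (\sum_(i < d) x ord0 i ^+ 2).

Definition grad (R : realType) (d : nat) (g : 'rV[R]_d -> R) (x : 'rV[R]_d) :
  'rV[R]_d := \row_(i < d) 'D_(delta_mx ord0 i) g x.

Definition smooth (R : realType) (d : nat) (L : R) (g : 'rV[R]_d -> R) : Prop :=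
  (forall x, differentiable g x) /\
  (forall x y, enorm (grad g x - grad g y) <= L * enorm (x - y)).

Definition avg_fun (R : realType) (d T : nat) (f : 'I_T -> 'rV[R]_d -> R)
  (x : 'rV[R]_d) : R := T%:R^-1 * \sum_(t < T) f t x.

Definition is_minimizer (R : realType) (d : nat) (g : 'rV[R]_d -> R)
  (x : 'rV[R]_d) : Prop := forall y, g x <= g y.

(* At the minimizer x_* this is the quantity sigma_*^2. *)
Definition grad_var (R : realType) (d T : nat) (f : 'I_T -> 'rV[R]_d -> R)
  (x : 'rV[R]_d) : R := T%:R^-1 * \sum_(t < T) enorm (grad (f t) x) ^+ 2.

(* [enum 'I_T] is increasing, so the components are visited in their order. *)
Definition igd_epoch (R : realType) (d T : nat) (f : 'I_T -> 'rV[R]_d -> R)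
    (eta : R) (x : 'rV[R]_d) : 'rV[R]_d :=
  foldl (fun y t => y - eta *: grad (f t) y) x (enum 'I_T).

(* [igd f eta x0 k] is x_k; epoch k, for k >= 1, uses the step size [eta k]. *)
Fixpoint igd (R : realType) (d T : nat) (f : 'I_T -> 'rV[R]_d -> R)
    (eta : nat -> R) (x0 : 'rV[R]_d) (k : nat) : 'rV[R]_d :=
  if k is k'.+1 then igd_epoch f (eta k) (igd f eta x0 k') else x0.

(* Main.v *)
(* Let F = f - f(x_* ), c = alpha / beta and a = 1 / (1 + c).  One epoch satisfies,
   for every comparison point z,
     F(x_k) <= (1 + c) F(z) + (|x_(k-1) - z|^2 - |x_k - z|^2) / (2 eta T)
               + eta^2 T^2 sigma_*^2 L:
   smoothness and cocoercivity of each f_t at the inner iterates leave the drift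
   terms |sum_(s >= t) g_s|^2, with g_s the gradients used in the epoch, and writing
     g_s = (g_s - grad f_s(z)) + (grad f_s(z) - grad f_s(x_* )) + grad f_s(x_* )
   with Young weights beta, alpha, 2 (whence 1/alpha + 1/beta <= 1/2) absorbs the
   first part in the cocoercivity gain and bounds the second by F(z).
   Choosing z as suitable convex combinations of x_* and the past iterates and
   weighting the epoch with m epochs left by m^(- a) makes these inequalities
   telescope to a bound on F(x_K); the factor e of the theorem is then slack.
   The complexity follows with K of order Y ln(e + X), where Y = X / T, and
   1 / (eta T) of order sqrt(ln K) (L + sqrt L sigma_* / sqrt eps). *)

Require Import Defs.
From HB Require Import structures.
From mathcomp Require Import all_boot all_order all_algebra.
From mathcomp Require Import all_classical all_reals all_analysis.
From mathcomp Require Import ring lra.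

Set Implicit Arguments.
Unset Strict Implicit.
Unset Printing Implicit Defensive.

Import Order.TTheory GRing.Theory Num.Theory.
Import numFieldNormedType.Exports.

Local Open Scope classical_set_scope.
Local Open Scope ring_scope.

(** * Euclidean inner product and quadratic inequalities *)

Definition dotv (R : realType) (d : nat) (x y : 'rV[R]_d) : R :=
  \sum_(i < d) x ord0 i * y ord0 i.

Section DotProduct.
Context {R : realType} {d : nat}.
Implicit Types (x y z u v w : 'rV[R]_d) (a b : R).

Lemma dotvC x y : dotv x y = dotv y x.
Proof. by apply: eq_bigr => i _; rewrite mulrC. Qed.

Lemma dotvDl x y z : dotv (x + y) z = dotv x z + dotv y z.
Proof. by rewrite /dotv -big_split; apply: eq_bigr => i _; rewrite mxE mulrDl. Qed.

Lemma dotvZl a x y : dotv (a *: x) y = a * dotv x y.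
Proof. by rewrite /dotv big_distrr; apply: eq_bigr => i _; rewrite mxE /= mulrA. Qed.

Lemma dotvNl x y : dotv (- x) y = - dotv x y.
Proof. by rewrite -scaleN1r dotvZl mulN1r. Qed.

Lemma dotv0l y : dotv 0 y = 0.
Proof. by rewrite -(scale0r 0) dotvZl mul0r. Qed.

Lemma dotvDr x y z : dotv x (y + z) = dotv x y + dotv x z.
Proof. by rewrite dotvC dotvDl !(dotvC x). Qed.

Lemma dotvZr a x y : dotv x (a *: y) = a * dotv x y.
Proof. by rewrite dotvC dotvZl dotvC. Qed.

Lemma dotvNr x y : dotv x (- y) = - dotv x y.
Proof. by rewrite dotvC dotvNl dotvC. Qed.

Lemma dotv_suml (I : finType) (P : pred I) (F : I -> 'rV[R]_d) y :
  dotv (\sum_(i | P i) F i) y = \sum_(i | P i) dotv (F i) y.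
Proof.
by elim/big_rec2: _ => [|i a b _ <-]; rewrite ?dotv0l// dotvDl.
Qed.

Definition dotvE := (dotvDl, dotvDr, dotvNl, dotvNr, dotvZl, dotvZr).

Lemma dotvv_ge0 x : 0 <= dotv x x.
Proof. by apply: sumr_ge0 => i _; rewrite -expr2 sqr_ge0. Qed.

Lemma dotvv_eq0 x : dotv x x = 0 -> x = 0.
Proof.
move=> /eqP; rewrite psumr_eq0; last by move=> i _; rewrite -expr2 sqr_ge0.
move=> /allP x0; apply/rowP => i; rewrite mxE; apply/eqP.
by have := x0 i (mem_index_enum i); rewrite /= -expr2 sqrf_eq0.
Qed.

Lemma enorm_sqr x : enorm x ^+ 2 = dotv x x.
Proof.
rewrite sqr_sqrtr; first by apply: eq_bigr => i _; rewrite expr2.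
by apply: sumr_ge0 => i _; rewrite sqr_ge0.
Qed.

Lemma enorm_ge0 x : 0 <= enorm x.
Proof. exact: sqrtr_ge0. Qed.

Lemma dotv_amgm a u v : 0 < a -> 2 * dotv u v <= a^-1 * dotv u u + a * dotv v v.
Proof.
move=> a0; have := dotvv_ge0 (u - a *: v); rewrite !dotvE (dotvC v u) => h.
rewrite -(ler_pM2l a0) mulrDr mulVKf ?gt_eqF//; lra.
Qed.

(** Cauchy-Schwarz, by expanding the squared deviations of the terms from [T%:R^-1 *: S]. Terms
    outside [P] become zero, so partial sums are bounded by the full sum of squares. *)
Lemma dotv_sum_sqr_le (T : nat) (P : pred 'I_T) (F : 'I_T -> 'rV[R]_d) :
  dotv (\sum_(i | P i) F i) (\sum_(i | P i) F i) <=
  T%:R * \sum_i dotv (F i) (F i).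
Proof.
case: T => [|n] in P F *; first by rewrite !big_ord0 dotv0l mulr0.
set T := n.+1 in P F *; have T0 : 0 < T%:R :> R by rewrite ltr0n.
set S := \sum_(i | P i) F i.
pose G i := if P i then F i else 0.
have SE : S = \sum_i G i by rewrite /S big_mkcond.
have GF : \sum_i dotv (G i) (G i) <= \sum_i dotv (F i) (F i).
  apply: ler_sum => i _; rewrite /G; case: ifP => // _.
  by rewrite dotv0l dotvv_ge0.
have : 0 <= \sum_i dotv (G i - T%:R^-1 *: S) (G i - T%:R^-1 *: S).
  by apply: sumr_ge0 => i _; exact: dotvv_ge0.
rewrite (eq_bigr (fun i => dotv (G i) (G i)
    + ((- (2 * T%:R^-1)) * dotv (G i) S + T%:R^-1 ^+ 2 * dotv S S))); last first.
  by move=> i _; rewrite !dotvE (dotvC S); ring.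
rewrite !big_split /= -mulr_sumr -dotv_suml -SE sumr_const card_ord.
rewrite -[X in _ + (_ + X)]mulr_natl => h.
apply: (@le_trans _ _ (T%:R * \sum_i dotv (G i) (G i))); last by rewrite ler_wpM2l// ltW.
rewrite -subr_ge0.
have -> : T%:R * (\sum_i dotv (G i) (G i)) - dotv S S =
  T%:R * (\sum_i dotv (G i) (G i) +
    (- (2 * T%:R^-1) * dotv S S + T%:R * (T%:R^-1 ^+ 2 * dotv S S))).
  by field; rewrite gt_eqF.
by rewrite mulr_ge0// ltW.
Qed.

(** Two Young inequalities: the pair [u], [v] gets the constant [a^-1 + b^-1 <= 1 / 2], and
    splitting off [w] costs a factor 2 that cancels this half. *)
Lemma dotv_add3_sqr_le a b u v w : 0 < a -> 0 < b -> a^-1 + b^-1 <= 1 / 2 ->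
  dotv (u + v + w) (u + v + w) <=
  a * dotv u u + b * dotv v v + 2 * dotv w w.
Proof.
move=> a0 b0 ab.
pose s := a^-1 + b^-1.
have s0 : 0 < s by rewrite addr_gt0// invr_gt0.
have h1 := dotvv_ge0 (a *: u - b *: v).
have h2 := dotvv_ge0 (u + v - w).
have huv : dotv (u + v) (u + v) <= s * (a * dotv u u + b * dotv v v).
  have -> : s * (a * dotv u u + b * dotv v v) =
    dotv (u + v) (u + v) + (a * b)^-1 * dotv (a *: u - b *: v) (a *: u - b *: v).
    by rewrite /s !dotvE (dotvC v u); field; rewrite !gt_eqF.
  by rewrite lerDl mulr_ge0// invr_ge0 mulr_ge0// ltW.
have hh : s * (a * dotv u u + b * dotv v v) <= 1 / 2 * (a * dotv u u + b * dotv v v).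
  by apply: ler_wpM2r => //; rewrite addr_ge0// mulr_ge0 ?dotvv_ge0// ltW.
move: h2 huv; rewrite !dotvE (dotvC v u) (dotvC w u) (dotvC w v); lra.
Qed.

End DotProduct.

(** * Smooth convex functions: quadratic bounds and cocoercivity *)

Section SmoothConvex.
Context {R : realType} {d : nat}.
Implicit Types (f : 'rV[R]_d -> R) (x y z v : 'rV[R]_d) (L : R).

Lemma derive_grad f x v : differentiable f x -> 'D_v f x = dotv (grad f x) v.
Proof.
move=> df; rewrite deriveE// {1}(matrix_sum_delta v) big_ord1.
rewrite linear_sum; apply: eq_bigr => i _.
by rewrite linearZ /= mxE deriveE// mulrC.
Qed.

Lemma is_derive_line f x v (s : R) : differentiable f (x + s *: v) ->
  is_derive s 1 (fun t : R => f (x + t *: v)) (dotv (grad f (x + s *: v)) v).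
Proof.
move=> df; rewrite -derive_grad//.
have E : (fun h : R => h^-1 *: (((fun t : R => f (x + t *: v)) \o shift s) (h *: 1)
    - f (x + s *: v))) =
    (fun h => h^-1 *: ((f \o shift (x + s *: v)) (h *: v) - f (x + s *: v))).
  apply/funext => h /=; congr (_ *: (f _ - _)).
  by rewrite [h *: 1]mulr1 scalerDl addrCA.
by split; rewrite /derivable /derive E//; exact: diff_derivable.
Qed.

(** The mean value theorem replaces integration along the segment: after subtracting b t^2 with b
    equal to plus or minus [L / 2 * dotv v v], the sign of the derivative at the intermediate point
    is known. *)
Lemma smooth_descent L f x v : 0 < L -> smooth L f ->
  `|f (x + v) - f x - dotv (grad f x) v| <= L / 2 * dotv v v.
Proof.
move=> L0 [df gL].
have key (b : R) : exists2 c, 0 < c & f (x + v) - f x - dotv (grad f x) v - b =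
    dotv (grad f (x + c *: v) - grad f x) v - 2 * b * c.
  pose h := fun t : R => f (x + t *: v) - (t * dotv (grad f x) v + b * t ^+ 2).
  have dh (s : R) : is_derive s 1 h (dotv (grad f (x + s *: v) - grad f x) v - 2 * b * s).
    have h1 := @is_derive_line f x v s (df _).
    have h2 : is_derive s 1 (fun t : R => t * dotv (grad f x) v + b * t ^+ 2)
        (dotv (grad f x) v + 2 * b * s).
      pose p : {poly R} := (dotv (grad f x) v) *: 'X + b *: 'X ^+ 2.
      have -> : (fun t : R => t * dotv (grad f x) v + b * t ^+ 2) = horner p.
        by apply/funext => t; rewrite /p !hornerE mulrC.
      have -> : dotv (grad f x) v + 2 * b * s = p^`().[s].
        by rewrite /p derivD !derivZ derivX derivXn !hornerE; ring.
      exact: is_derive_poly.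
    have -> : dotv (grad f (x + s *: v) - grad f x) v - 2 * b * s =
      dotv (grad f (x + s *: v)) v - (dotv (grad f x) v + 2 * b * s).
      by rewrite !dotvE; ring.
    exact: is_deriveB.
  have [c] := @MVT R h _ 0 1 ltr01 (fun s _ => dh s)
    (derivable_within_continuous (fun s _ => @ex_derive _ _ _ _ _ _ _ (dh s))).
  rewrite in_itv /= => /andP[c0 _] hc; exists c => //.
  move: hc; rewrite /h scale1r scale0r !addr0 subr0; lra.
have bnd (c : R) : 0 < c -> `|dotv (grad f (x + c *: v) - grad f x) v| <= L * c * dotv v v.
  move=> c0; set g := _ - _.
  have gb : dotv g g <= (L * c) ^+ 2 * dotv v v.
    have h := gL (x + c *: v) x; rewrite -/g in h.
    rewrite -enorm_sqr; apply: le_trans (_ : (L * enorm (x + c *: v - x)) ^+ 2 <= _).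
      by rewrite ler_pXn2r// nnegrE ?mulr_ge0 ?enorm_ge0// ltW.
    by rewrite exprMn enorm_sqr addrC addKr dotvZl dotvZr; lra.
  have Lc : 0 < L * c by rewrite mulr_gt0.
  have gb' : (L * c)^-1 * dotv g g <= L * c * dotv v v.
    by rewrite mulrC ler_pdivrMr//; apply: le_trans gb _; rewrite expr2; lra.
  (* AM-GM with weight [L * c], applied to [g] and [- g], stands in for Cauchy-Schwarz. *)
  have h1 := dotv_amgm g v Lc.
  have h2 := dotv_amgm (- g) v Lc.
  rewrite !dotvNl !dotvNr in h2.
  rewrite ler_norml; apply/andP; split; lra.
rewrite ler_norml; apply/andP; split.
  have [c c0 hc] := key (- (L / 2 * dotv v v)).
  have := bnd _ c0; rewrite ler_norml => /andP[h1 h2]; lra.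
have [c c0 hc] := key (L / 2 * dotv v v).
have := bnd _ c0; rewrite ler_norml => /andP[h1 h2]; lra.
Qed.

Lemma convex_functionP f x y (t : R) : convex_function [set: 'rV[R]_d] f ->
  0 <= t -> t <= 1 -> f (t *: x + (1 - t) *: y) <= t * f x + (1 - t) * f y.
Proof.
move=> cf t0 t1.
have t01 : Itv.spec (@Itv.num_sem R) (Itv.Real `[0%Z, 1%Z]%Z) t.
  by rewrite /= /Itv.num_sem /= num_real in_itv /= t0 t1.
have := cf (Itv.mk t01) x y.
by rewrite !inE => /(_ Logic.I Logic.I).
Qed.

(* Dividing the two-sided quadratic bound at [x + s *: (y - x)] by [s] and letting
   [s] shrink replaces the usual limit of difference quotients. *)
Lemma convex_grad_le L f x y : 0 < L -> smooth L f ->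
  convex_function [set: 'rV[R]_d] f -> f x + dotv (grad f x) (y - x) <= f y.
Proof.
move=> L0 sf cf; set v := y - x.
have key (s : R) : 0 < s -> s <= 1 -> f x + dotv (grad f x) v <= f y + L / 2 * dotv v v * s.
  move=> s0 s1.
  have := smooth_descent x (s *: v) L0 sf.
  rewrite ler_norml => /andP[h1 _]; rewrite !dotvZr !dotvZl in h1.
  have := convex_functionP y x cf (ltW s0) s1.
  have -> : s *: y + (1 - s) *: x = x + s *: v.
    by rewrite /v scalerBr scalerBl scale1r addrCA addrA.
  move=> h2; rewrite -(ler_pM2l s0); lra.
apply/ler_addgt0Pr => e e0.
set q := L / 2 * dotv v v in key *.
have q0 : 0 <= q by rewrite mulr_ge0 ?dotvv_ge0// divr_ge0// ltW.
(* The denominator is [q + 1] because [q] may vanish. *)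
pose s := Num.min 1 (e / (q + 1)).
have s0 : 0 < s by rewrite lt_min ltr01 divr_gt0// ltr_wpDl.
have s1 : s <= 1 by rewrite ge_min lexx.
apply: le_trans (key s s0 s1) _; rewrite lerD2l.
apply: (@le_trans _ _ ((q + 1) * (e / (q + 1)))).
  by apply: ler_pM => //; [exact: ltW | rewrite lerDl | rewrite ge_min lexx orbT].
by rewrite mulrC divfK// gt_eqF// ltr_wpDl.
Qed.

(** The value at [y - L^-1 *: g] is bounded below by the tangent at [x] and above by the quadratic
    bound at [y]; comparing the two leaves the square of [g]. *)
Lemma convex_cocoercive L f x y : 0 < L -> smooth L f ->
  convex_function [set: 'rV[R]_d] f ->
  f x + dotv (grad f x) (y - x) +
    (2 * L)^-1 * dotv (grad f y - grad f x) (grad f y - grad f x) <= f y.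
Proof.
move=> L0 sf cf; set g := grad f y - grad f x.
have := smooth_descent y (- (L^-1 *: g)) L0 sf.
rewrite ler_norml => /andP[_].
have := convex_grad_le x (y - L^-1 *: g) L0 sf cf.
have -> : grad f y = grad f x + g by rewrite /g addrC subrK.
clearbody g.
rewrite !dotvE.
have e1 : L / 2 * (L^-1 * (L^-1 * dotv g g)) = (2 * L)^-1 * dotv g g.
  by field; rewrite gt_eqF.
have e2 : L^-1 * dotv g g = 2 * ((2 * L)^-1 * dotv g g) by field; rewrite gt_eqF.
move: e1 e2; lra.
Qed.

End SmoothConvex.

(** * The inequality for one epoch *)

Section Epoch.
Context {R : realType} {d T : nat}.
Context (f : 'I_T -> 'rV[R]_d -> R) (L : R).
Context (T_gt0 : (0 < T)%N) (L_gt0 : 0 < L).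
Context (f_convex : forall t, convex_function [set: 'rV[R]_d] (f t)).
Context (f_smooth : forall t, smooth L (f t)).

Let TR_gt0 : 0 < T%:R :> R. Proof. by rewrite ltr0n. Qed.

Lemma sum_avg_fun x : \sum_t f t x = T%:R * avg_fun f x.
Proof. by rewrite /avg_fun mulVKf// gt_eqF. Qed.

Lemma grad_var_ge0 x : 0 <= grad_var f x.
Proof. by rewrite mulr_ge0 ?invr_ge0 ?ler0n// sumr_ge0// => t _; rewrite sqr_ge0. Qed.

Lemma avg_fun_convex x y (t : R) : 0 <= t -> t <= 1 ->
  avg_fun f (t *: x + (1 - t) *: y) <= t * avg_fun f x + (1 - t) * avg_fun f y.
Proof.
move=> t0 t1; rewrite -(ler_pM2l TR_gt0) -sum_avg_fun.
have -> : T%:R * (t * avg_fun f x + (1 - t) * avg_fun f y) =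
    t * (T%:R * avg_fun f x) + (1 - t) * (T%:R * avg_fun f y) by ring.
rewrite -!sum_avg_fun !mulr_sumr -big_split; apply: ler_sum => i _.
exact: convex_functionP.
Qed.

(** The step [- (s *: G)] lowers the sum of the components by at least [s / 2 * dotv G G], which
    minimality allows only for [G = 0]. *)
Lemma sum_grad_minimizer x : is_minimizer (avg_fun f) x ->
  \sum_t grad (f t) x = 0.
Proof.
move=> xmin; set G := \sum_t _; apply: dotvv_eq0.
pose s := (T%:R * L)^-1.
have TL : 0 < T%:R * L by rewrite mulr_gt0.
have s0 : 0 < s by rewrite invr_gt0.
have h1 : \sum_t f t x <= \sum_t f t (x - s *: G).
  by rewrite !sum_avg_fun ler_pM2l.
have h2 : \sum_t f t (x - s *: G) <=
    \sum_t (f t x + (- s * dotv (grad (f t) x) G + L / 2 * (s ^+ 2 * dotv G G))).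
  apply: ler_sum => t _.
  have := smooth_descent x (- (s *: G)) L_gt0 (f_smooth t).
  rewrite ler_norml => /andP[_]; rewrite !(dotvNl, dotvNr) !(dotvZl, dotvZr); lra.
move: (le_trans h1 h2); rewrite big_split /= lerDl big_split /= -mulr_sumr -dotv_suml -/G.
rewrite sumr_const card_ord -[X in _ + X]mulr_natl.
have -> : T%:R * (L / 2 * (s ^+ 2 * dotv G G)) = s / 2 * dotv G G.
  by rewrite /s; field; rewrite !gt_eqF.
move=> h; apply/eqP; rewrite eq_le dotvv_ge0 andbT -(pmulr_rle0 _ s0); lra.
Qed.

(** Cocoercivity at [xs], summed over [t]; the linear terms cancel since the gradients at [xs] sum
    to zero. *)
Lemma sum_grad_dist_le xs z : is_minimizer (avg_fun f) xs ->
  \sum_t dotv (grad (f t) z - grad (f t) xs) (grad (f t) z - grad (f t) xs) <=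
  2 * L * T%:R * (avg_fun f z - avg_fun f xs).
Proof.
move=> xmin.
have h : \sum_t (f t xs + (dotv (grad (f t) xs) (z - xs) + (2 * L)^-1 *
    dotv (grad (f t) z - grad (f t) xs) (grad (f t) z - grad (f t) xs))) <=
    \sum_t f t z.
  by apply: ler_sum => t _; rewrite addrA; exact: convex_cocoercive.
move: h; rewrite big_split /= big_split /= -dotv_suml sum_grad_minimizer// dotv0l add0r.
rewrite -mulr_sumr !sum_avg_fun -lerBrDl mulrC ler_pdivrMr ?mulr_gt0//; lra.
Qed.

(** The point after [n] steps of the epoch; indices start at 0, so [inner eta x t] is where the
    gradient of component [t] is taken. *)
Let inner (eta : R) (x : 'rV[R]_d) n :=
  foldl (fun y t => y - eta *: grad (f t) y) x (take n (enum 'I_T)).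

Let innerE eta x n : (n <= T)%N ->
  inner eta x n = x - eta *: \sum_(i < T | (i < n)%N) grad (f i) (inner eta x i).
Proof.
elim: n => [_|n IH nT]; first by rewrite /inner take0 /= big_pred0 // scaler0 subr0.
pose i0 := Ordinal nT.
rewrite {1}/inner (take_nth i0) ?size_enum_ord// foldl_rcons.
rewrite -/(inner eta x n) (nth_ord_enum i0 i0) {1}IH; last exact: ltnW.
rewrite [in RHS](bigD1 i0) /=; last exact: ltnSn.
rewrite scalerDr opprD [- (eta *: grad _ _) - _]addrC addrA.
congr (_ - _ *: _ - _); apply: eq_bigl => i.
by rewrite -val_eqE /= ltnS ltn_neqAle andbC.
Qed.

(** The [y t] are the points where the gradients are taken. The end of the epoch differs from [y t]
    by [eta] times the sum of the gradients from index [t] on; Cauchy-Schwarz bounds this drift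
    uniformly in [t]. *)
Lemma igd_epochP (eta : R) (x : 'rV[R]_d) : exists y : 'I_T -> 'rV[R]_d,
  igd_epoch f eta x = x - eta *: \sum_t grad (f t) (y t) /\
  forall t, dotv (igd_epoch f eta x - y t) (igd_epoch f eta x - y t) <=
    eta ^+ 2 * (T%:R * \sum_i dotv (grad (f i) (y i)) (grad (f i) (y i))).
Proof.
exists (fun t => inner eta x t).
have eE : igd_epoch f eta x = inner eta x T.
  by rewrite /inner take_oversize// size_enum_ord.
rewrite eE innerE//; split.
  by congr (_ - _ *: _); apply: eq_bigl => i; rewrite ltn_ord.
move=> t; rewrite [inner eta x t]innerE; last exact: ltnW.
set g := fun i : 'I_T => grad (f i) (inner eta x i).
have -> : x - eta *: (\sum_(i < T | (i < T)%N) g i) -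
    (x - eta *: (\sum_(i < T | (i < t)%N) g i)) =
    - eta *: \sum_(i < T | ~~ (i < t)%N) g i.
  rewrite (bigID (fun i : 'I_T => (i < t)%N)) /= scalerDr.
  rewrite [X in eta *: X + _](eq_bigl (fun i : 'I_T => (i < t)%N)); last first.
    by move=> i; rewrite ltn_ord.
  rewrite [X in _ + eta *: X](eq_bigl (fun i : 'I_T => ~~ (i < t)%N)); last first.
    by move=> i; rewrite ltn_ord.
  by rewrite opprB addrC addrA subrK opprD addrA subrr sub0r scaleNr.
rewrite dotvZl dotvZr mulrA mulrNN -expr2.
by rewrite ler_wpM2l ?sqr_ge0// dotv_sum_sqr_le.
Qed.

Lemma igd_epoch_le (xs x z : 'rV[R]_d) (alpha beta eta : R)
    (x' := igd_epoch f eta x) :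
  is_minimizer (avg_fun f) xs ->
  0 < alpha -> 0 < beta -> alpha^-1 + beta^-1 <= 1 / 2 ->
  0 < eta -> eta <= 1 / (Num.sqrt beta * T%:R * L) ->
  avg_fun f x' - avg_fun f z <=
    (2 * eta * T%:R)^-1 * (dotv (x - z) (x - z) - dotv (x' - z) (x' - z)) +
    alpha / beta * (avg_fun f z - avg_fun f xs) +
    eta ^+ 2 * T%:R ^+ 2 * grad_var f xs * L.
Proof.
move=> xmin a0 b0 ab e0 eb.
have [y [x'E yle]] := igd_epochP eta x; rewrite -/x' in x'E yle.
pose g t := grad (f t) (y t).
pose G := \sum_t dotv (g t) (g t).
pose U := \sum_t dotv (g t - grad (f t) z) (g t - grad (f t) z).
pose V := \sum_t dotv (grad (f t) z - grad (f t) xs) (grad (f t) z - grad (f t) xs).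
pose W := T%:R * grad_var f xs.
have WE : W = \sum_t dotv (grad (f t) xs) (grad (f t) xs).
  by rewrite /W /grad_var mulVKf ?gt_eqF//; apply: eq_bigr => t _; rewrite enorm_sqr.
have GUVW : G <= beta * U + alpha * V + 2 * W.
  rewrite WE !mulr_sumr -!big_split; apply: ler_sum => t _ /=.
  have := @dotv_add3_sqr_le R d beta alpha (g t - grad (f t) z)
    (grad (f t) z - grad (f t) xs) (grad (f t) xs) b0 a0.
  by rewrite (addrA (_ - _)) !subrK; apply; rewrite addrC.
have VF := sum_grad_dist_le z xmin; rewrite -/V in VF.
have V0 : 0 <= V by apply: sumr_ge0 => t _; exact: dotvv_ge0.
have U0 : 0 <= U by apply: sumr_ge0 => t _; exact: dotvv_ge0.
(* [r * G] is the drift error summed over all [T] components. *)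
pose r := L / 2 * (eta ^+ 2 * T%:R ^+ 2).
have r0 : 0 <= r by rewrite !mulr_ge0 ?sqr_ge0 ?invr_ge0// ltW.
(* The squared step-size condition; it lets the cocoercivity gain absorb [r * beta * U]. *)
have rb : r * beta <= (2 * L)^-1.
  have h : (eta * (Num.sqrt beta * T%:R * L)) ^+ 2 <= 1.
    rewrite expr_le1// ?mulr_ge0 ?sqrtr_ge0 ?(ltW e0) ?(ltW L_gt0) ?ler0n//.
    by rewrite -ler_pdivlMr// !mulr_gt0// sqrtr_gt0.
  rewrite !exprMn sqr_sqrtr ?(ltW b0)// in h.
  rewrite -div1r ler_pdivlMr ?mulr_gt0// /r; lra.
(* Smoothness leads from [y t] to [x'] and cocoercivity from [y t] to [z]; combining them eliminates
   [f t (y t)]. *)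
have step : \sum_t f t x' <= \sum_t (f t z + (dotv (g t) (x' - z) +
    (L / 2 * (eta ^+ 2 * (T%:R * G)) -
    (2 * L)^-1 * dotv (g t - grad (f t) z) (g t - grad (f t) z)))).
  apply: ler_sum => t _.
  have h1 := smooth_descent (y t) (x' - y t) L_gt0 (f_smooth t).
  rewrite ler_norml [y t + _]addrC subrK in h1; case/andP: h1 => _ h1.
  have h2 := convex_cocoercive (y t) z L_gt0 (f_smooth t) (f_convex t).
  have h3 := yle t; rewrite -/G in h3.
  rewrite -(ler_pM2l (_ : 0 < L / 2)) in h3; last by rewrite divr_gt0.
  have -> : dotv (g t - grad (f t) z) (g t - grad (f t) z) =
    dotv (grad (f t) z - g t) (grad (f t) z - g t).
    by rewrite -opprB dotvNl dotvNr opprK.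
  have -> : x' - z = (x' - y t) - (z - y t) by rewrite opprB addrA subrK.
  rewrite dotvDr dotvNr; rewrite -/(g t) in h1 h2; lra.
move: step; rewrite big_split /= big_split /= -dotv_suml sumrB sumr_const card_ord.
rewrite -mulr_sumr -/U -[_ *+ T]mulr_natl.
have -> : T%:R * (L / 2 * (eta ^+ 2 * (T%:R * G))) = r * G by rewrite /r; ring.
rewrite !sum_avg_fun.
set S := \sum_t g t; rewrite -/S in x'E.
(* Polarization with [eta *: S = x - x']; half the squared length of [x - x'] is dropped. *)
have SE : eta * dotv S (x' - z) <=
    1 / 2 * (dotv (x - z) (x - z) - dotv (x' - z) (x' - z)).
  rewrite -dotvZl.
  have -> : eta *: S = (x - z) - (x' - z).
    by rewrite opprB addrA subrK x'E opprB addrC subrK.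
  have := dotvv_ge0 ((x - z) - (x' - z)).
  rewrite !(dotvDl (x - z)) !(dotvDr _ (x - z)) !(dotvNl (x' - z)) !(dotvNr _ (x' - z)).
  rewrite (dotvC (x' - z) (x - z)); lra.
have rG := ler_wpM2l r0 GUVW.
have rU := ler_wpM2r U0 rb.
have rV : r * alpha * V <= alpha / beta * (T%:R * (avg_fun f z - avg_fun f xs)).
  have h : r * alpha <= alpha / beta * (2 * L)^-1.
    by rewrite -mulrA mulrC ler_pM2l// mulrC ler_pdivlMr.
  apply: le_trans (ler_wpM2r V0 h) _; rewrite -[X in X <= _]mulrA ler_wpM2l ?divr_ge0 ?(ltW a0) ?(ltW b0)//.
  rewrite mulrC ler_pdivrMr ?mulr_gt0//; lra.
have rW : r * (2 * W) = T%:R * (eta ^+ 2 * T%:R ^+ 2 * grad_var f xs * L).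
  by rewrite /r /W; field.
move=> step; rewrite -(ler_pM2l TR_gt0).
have -> : T%:R * ((2 * eta * T%:R)^-1 *
     (dotv (x - z) (x - z) - dotv (x' - z) (x' - z)) +
     alpha / beta * (avg_fun f z - avg_fun f xs) +
     eta ^+ 2 * T%:R ^+ 2 * grad_var f xs * L) =
   eta^-1 * (1 / 2 * (dotv (x - z) (x - z) - dotv (x' - z) (x' - z))) +
   alpha / beta * (T%:R * (avg_fun f z - avg_fun f xs)) +
   r * (2 * W).
  by rewrite rW; field; rewrite !gt_eqF.
have : dotv S (x' - z) <=
    eta^-1 * (1 / 2 * (dotv (x - z) (x - z) - dotv (x' - z) (x' - z))).
  by rewrite [eta^-1 * _]mulrC ler_pdivlMr// mulrC.
lra.
Qed.

End Epoch.

(** * Inequalities for power weights *)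

Section PowerWeights.
Context {R : realType}.

(** Concavity of [ln] at [1 + x] and 1, with weights [a] and [1 - a]. *)
Lemma powR_bernoulli (x a : R) : -1 < x -> 0 <= a -> a <= 1 ->
  (1 + x) `^ a <= 1 + a * x.
Proof.
move=> x1 a0 a1.
have p1 : 0 < 1 + x by lra.
have t01 : Itv.spec (@Itv.num_sem R) (Itv.Real `[0%Z, 1%Z]%Z) a.
  by rewrite /= /Itv.num_sem /= num_real in_itv /= a0 a1.
have p2 : 0 < 1 + a * x.
  have [a_lt1|a_ge1] := ltP a 1; first by have := mulr_ge0 a0 (ltW p1); lra.
  by have -> : a = 1; lra.
have : a * ln (1 + x) + (1 - a) * ln 1 <= ln (a * (1 + x) + (1 - a) * 1).
  exact: (concave_ln (Itv.mk t01) p1 ltr01).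
rewrite ln1 mulr0 addr0 (_ : a * (1 + x) + (1 - a) * 1 = 1 + a * x); last by ring.
by rewrite -ln_powR ler_ln// posrE powR_gt0.
Qed.

(** Bernoulli at [m^-1], after factoring the weight at [m.+1] out of the weight at [m]. *)
Lemma powR_weight_incr (a : R) (m : nat) : 0 <= a -> a <= 1 -> (0 < m)%N ->
  m%:R * (m%:R `^ (- a) - m.+1%:R `^ (- a)) <= a * m.+1%:R `^ (- a).
Proof.
move=> a0 a1 m0; have mR : 0 < m%:R :> R by rewrite ltr0n.
have E : m%:R `^ (- a) = m.+1%:R `^ (- a) * (1 + m%:R^-1) `^ a.
  have -> : 1 + m%:R^-1 = m.+1%:R / m%:R :> R by rewrite -natr1; field; rewrite gt_eqF.
  rewrite powRM ?invr_ge0// mulrA -powRD; last by rewrite pnatr_eq0 implybT.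
  by rewrite addNr powRr0 mul1r -powR_inv1 ?ler0n// -powRrM mulN1r.
have b := @powR_bernoulli m%:R^-1 a _ a0 a1.
have {}b : (1 + m%:R^-1) `^ a <= 1 + a * m%:R^-1.
  by apply: b; rewrite (lt_trans (ltrN10 _))// invr_gt0.
rewrite E -[X in _ * (_ - X)]mulr1 -mulrBr mulrCA mulrC ler_pM2r ?powR_gt0//.
by rewrite mulrC -ler_pdivlMr//; lra.
Qed.

(** One term of the comparison of a sum of powers with its integral: Bernoulli at [- n^-1], with [n]
    the larger index. The case [m = 0] is separate since Bernoulli excludes -1. *)
Lemma powR_weight_sum (b : R) (m : nat) : 0 < b -> b <= 1 ->
  b * m.+1%:R `^ (b - 1) <= m.+1%:R `^ b - m%:R `^ b.
Proof.
move=> b0 b1; case: m => [|m].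
  by rewrite !powR1 powR0 ?gt_eqF// subr0 mulr1.
set n := m.+2%:R; have n0 : 0 < n :> R by rewrite ltr0n.
have -> : m.+1%:R = n * (1 - n^-1) :> R.
  by rewrite mulrBr mulr1 mulfV ?gt_eqF// /n -[m.+2%:R]natr1 addrK.
have n1 : n^-1 < 1 by rewrite invf_lt1// /n ltr1n.
clearbody n.
rewrite powRM ?(ltW n0) ?subr_ge0 ?(ltW n1)//.
have B := @powR_bernoulli (- n^-1) b _ (ltW b0) b1.
have {}B : (1 - n^-1) `^ b <= 1 + b * - n^-1 by apply: B; rewrite ltrN2.
have E : n `^ (b - 1) = n `^ b * n^-1.
  by rewrite powRB ?powRr1 ?(ltW n0)// (gt_eqF n0) implybT.
rewrite E; have := ler_wpM2l (powR_ge0 n b) B; lra.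
Qed.

End PowerWeights.

(** * From one epoch to the last iterate *)

(* With [m] epochs left the epoch inequality gets weight [m `^ (- a)], and the
   comparison point moves towards the newest iterate just enough for the weighted
   inequalities to telescope. *)
Lemma last_iterate_le (R : realType) (d : nat) (F : 'rV[R]_d -> R)
    (X : nat -> 'rV[R]_d) (xs : 'rV[R]_d) (A c E : R) (K : nat) (a := (1 + c)^-1) :
  0 <= A -> 0 < c -> 0 <= E -> (forall z, 0 <= F z) -> F xs = 0 ->
  (forall x y (t : R), 0 <= t -> t <= 1 ->
    F (t *: x + (1 - t) *: y) <= t * F x + (1 - t) * F y) ->
  (forall k z, F (X k.+1) <= (1 + c) * F z +
    A * (dotv (X k - z) (X k - z) - dotv (X k.+1 - z) (X k.+1 - z)) + E) ->
  (0 < K)%N ->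
  F (X K) <= A * dotv (X 0%N - xs) (X 0%N - xs) * K%:R `^ (- a) +
    E * (K%:R `^ (1 - a) / (1 - a)).
Proof.
move=> A0 c0 E0 F0 Fxs Fcvx step K0.
have c1 : 0 < 1 + c by lra.
have a0 : 0 < a by rewrite invr_gt0.
have a1 : a < 1 by rewrite invf_lt1//; lra.
pose W m : R := m%:R `^ (- a).
have W0 m : (0 < m)%N -> 0 < W m by move=> m0; rewrite powR_gt0// ltr0n.
(* Moving the comparison point puts extra weight on F at the newest iterate; this bounds it by the
   weight of the epoch inequality. *)
have Winc m : (0 < m)%N -> (1 + c) * m%:R * (W m - W m.+1) <= W m.+1.
  move=> m0; have := powR_weight_incr (ltW a0) (ltW a1) m0.
  rewrite -/(W m) -/(W m.+1) -(ler_pM2l c1) mulrA => /le_trans; apply.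
  by rewrite mulrA mulfV ?gt_eqF// mul1r.
have Wle m : (0 < m)%N -> W m.+1 <= W m.
  move=> m0; rewrite /W !powRN lef_pV2 ?posrE ?powR_gt0 ?ltr0n//.
  by rewrite ge0_ler_powR ?nnegrE ?ler0n ?ler_nat// ltW.
(* [B m] dominates the sum of the first [m] weights, so the errors [E] telescope. *)
pose B m : R := m%:R `^ (1 - a) / (1 - a).
have BW m : W m.+1 <= B m.+1 - B m.
  rewrite /B -mulrBl ler_pdivlMr ?subr_gt0// mulrC.
  have := @powR_weight_sum R (1 - a) m.
  rewrite (_ : 1 - a - 1 = - a); last by ring.
  by apply; lra.
have B0 : B 0%N = 0 by rewrite /B powR0 ?mul0r// gt_eqF// subr_gt0.
(* Potential after [k] epochs with [m.+1] left; the point [z] starts at [xs]. *)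
have inv k m : (k + m.+1 = K)%N -> exists z,
    A * W m.+1 * dotv (X k - z) (X k - z) + (1 + c) * m.+1%:R * W m.+1 * F z <=
    A * W K * dotv (X 0%N - xs) (X 0%N - xs) + E * (B K - B m.+1).
  elim: k m => [|k IH] m kmK.
    by exists xs; rewrite Fxs mulr0 addr0 -kmK subrr mulr0 addr0.
  have [z hz] := IH m.+1 (etrans (addnS k m.+1) kmK).
  set w := W m.+2 in hz; set w' := W m.+1.
  have w'0 : 0 < w' by exact: W0.
  have w0 : 0 < w by exact: W0.
  have ww' : w <= w' by exact: Wle.
  (* With this ratio the new squared distance has weight [w' * l ^+ 2 <= w], while [F z] keeps
     weight [w]. *)
  pose l := w / w'.
  have l0 : 0 <= l by rewrite divr_ge0// ltW.
  have l1 : l <= 1 by rewrite ler_pdivrMr// mul1r.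
  have w'l : w' * l = w by rewrite mulrC divfK// gt_eqF.
  set x1 := X k.+1.
  exists (l *: z + (1 - l) *: x1).
  have -> : x1 - (l *: z + (1 - l) *: x1) = l *: (x1 - z).
    by rewrite scalerBl scale1r scalerBr opprD addrA addrAC subKr.
  rewrite dotvZl dotvZr.
  have hF := Fcvx z x1 l l0 l1.
  have hF' : w' * F (l *: z + (1 - l) *: x1) <= w * F z + (w' - w) * F x1.
    have := ler_wpM2l (ltW w'0) hF.
    have -> : w' * (l * F z + (1 - l) * F x1) = w' * l * F z + (w' - w' * l) * F x1 by ring.
    by rewrite w'l.
  have hD : A * w' * (l * (l * dotv (x1 - z) (x1 - z))) <= A * w * dotv (x1 - z) (x1 - z).
    have -> : A * w' * (l * (l * dotv (x1 - z) (x1 - z))) =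
      l * (A * (w' * l) * dotv (x1 - z) (x1 - z)) by ring.
    by rewrite w'l ler_piMl// !mulr_ge0 ?dotvv_ge0// ltW.
  have cm : 0 <= (1 + c) * m.+1%:R by rewrite mulr_ge0 ?ler0n// ltW.
  have hF2 := ler_wpM2l cm hF'.
  have hI := ler_wpM2r (F0 x1) (Winc m.+1 isT).
  rewrite -/w -/w' in hI.
  have hS := ler_wpM2l (ltW w0) (step k z).
  rewrite -/x1 in hS.
  have hE := ler_wpM2l E0 (BW m.+1).
  rewrite -/w in hE.
  (* Of the [m.+2] copies of [(1 + c) * w * F z], one pays for the epoch and [m.+1] for convexity at
     the new point. *)
  have m2 : m.+2%:R = m.+1%:R + 1 :> R by rewrite natr1.
  rewrite m2 in hz.
  lra.
(* The last epoch, of weight 1, is applied directly at the [z] of the invariant. *)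
case: K K0 inv => // K _ inv.
have [z] := inv K 0%N (addn1 K).
have hS := step K z.
have W1 : W 1%N = 1 by rewrite /W powR1.
have hE := ler_wpM2l E0 (BW 0%N).
have hD := dotvv_ge0 (X K.+1 - z).
have hAD : 0 <= A * dotv (X K.+1 - z) (X K.+1 - z) by rewrite mulr_ge0.
rewrite B0 W1 in hE; rewrite W1 -/(W K.+1) -/(B K.+1); lra.
Qed.

(** Instance [c = alpha / beta], for which [(1 - a)^-1] is [1 + beta / alpha]; no factor e appears
    yet. *)
Lemma igd_last_iterate_le (R : realType) (d T : nat) (L : R)
    (f : 'I_T -> 'rV[R]_d -> R) (x0 xs : 'rV[R]_d) (alpha beta eta : R) (K : nat)
    (a := (1 + alpha / beta)^-1) :
  (0 < T)%N -> 0 < L ->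
  (forall t, convex_function [set: 'rV[R]_d] (f t)) ->
  (forall t, smooth L (f t)) ->
  is_minimizer (avg_fun f) xs ->
  0 < alpha -> 0 < beta -> alpha^-1 + beta^-1 <= 1 / 2 ->
  0 < eta -> eta <= 1 / (Num.sqrt beta * T%:R * L) ->
  (0 < K)%N ->
  avg_fun f (igd f (fun=> eta) x0 K) - avg_fun f xs <=
    eta ^+ 2 * T%:R ^+ 2 * grad_var f xs * L * (1 + beta / alpha) * K%:R `^ (1 - a) +
    (2 * eta * T%:R)^-1 * enorm (x0 - xs) ^+ 2 * K%:R `^ (- a).
Proof.
move=> T0 L0 cf sf xmin a0 b0 ab e0 eb K0.
have c0 : 0 < alpha / beta by rewrite divr_gt0.
have TR : 0 < T%:R :> R by rewrite ltr0n.
have H := @last_iterate_le R d (fun z => avg_fun f z - avg_fun f xs)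
  (igd f (fun=> eta) x0) xs (2 * eta * T%:R)^-1 (alpha / beta)
  (eta ^+ 2 * T%:R ^+ 2 * grad_var f xs * L) K.
cbv zeta in H; rewrite -/a in H.
have aE : 1 - a = (1 + beta / alpha)^-1.
  by rewrite /a; field; rewrite !gt_eqF//= addr_gt0.
rewrite aE invrK in H; rewrite aE enorm_sqr.
apply: le_trans (H _ c0 _ _ _ _ _ K0) _.
- by rewrite invr_ge0 ltW// !mulr_gt0.
- by rewrite mulr_ge0 ?(ltW L0)// mulr_ge0 ?grad_var_ge0// mulr_ge0 ?sqr_ge0.
- by move=> z; rewrite subr_ge0.
- exact: subrr.
- move=> x y t t0 t1; have := avg_fun_convex T0 cf x y t0 t1; lra.
- move=> k z.
  have := @igd_epoch_le _ _ _ f L T0 L0 cf sf xs (igd f (fun=> eta) x0 k) z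
    alpha beta eta xmin a0 b0 ab e0 eb.
  rewrite [igd f _ x0 k.+1]/=; lra.
by rewrite addrC lerD2r mulrA mulrAC.
Qed.

(** * Choice of the number of epochs and of the step size *)

Lemma igd_complexity (R : realType) (d T : nat) (L : R)
    (f : 'I_T -> 'rV[R]_d -> R) (x0 xs : 'rV[R]_d) (eps : R)
    (D := enorm (x0 - xs)) (sigma := Num.sqrt (grad_var f xs))
    (X := T%:R * L * D ^+ 2 / eps +
      T%:R * L `^ (1 / 2) * sigma * D ^+ 2 / eps `^ (3 / 2)) :
  (0 < T)%N -> 0 < L ->
  (forall t, convex_function [set: 'rV[R]_d] (f t)) ->
  (forall t, smooth L (f t)) ->
  is_minimizer (avg_fun f) xs ->
  0 < eps -> T%:R <= X ->
  exists (K : nat) (eta : R),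
    [/\ 1 <= ln (K%:R : R),
        0 < eta,
        eta <= 1 / (Num.sqrt (4 * ln K%:R) * T%:R * L),
        avg_fun f (igd f (fun=> eta) x0 K) - avg_fun f xs <= eps &
        (T * K)%:R <= 32 * expR 1 ^+ 4 * X * ln (expR 1 + X)].
Proof.
move=> T0 L0 cf sf xmin eps0 TX.
have TR : 0 < T%:R :> R by rewrite ltr0n.
have T1 : 1 <= T%:R :> R by rewrite ler1n.
have sig0 : 0 <= sigma by exact: sqrtr_ge0.
have sigE : sigma ^+ 2 = grad_var f xs by rewrite sqr_sqrtr// grad_var_ge0.
pose e2 := Num.sqrt eps; have e20 : 0 < e2 by rewrite sqrtr_gt0.
have e2E : e2 ^+ 2 = eps by rewrite sqr_sqrtr// ltW.
pose L2 := Num.sqrt L; have L20 : 0 < L2 by rewrite sqrtr_gt0.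
have L2E : L2 ^+ 2 = L by rewrite sqr_sqrtr// ltW.
(* [M] merges both terms of [X] into one and satisfies [L * sigma ^+ 2 <= M ^+ 2 * eps]. *)
pose M := L + L2 * sigma / e2.
have LM : L <= M by rewrite lerDl divr_ge0 ?mulr_ge0// ltW.
have M0 : 0 < M by exact: lt_le_trans LM.
have ML : L * sigma ^+ 2 <= M ^+ 2 * eps.
  have h : L2 * sigma / e2 <= M by rewrite lerDr ltW.
  rewrite -e2E -exprMn -[X in X * _ <= _]L2E -exprMn.
  rewrite ler_pXn2r ?nnegrE ?mulr_ge0 ?(ltW L20) ?(ltW e20) ?(ltW M0)//.
  by rewrite -ler_pdivrMr.
pose Y := M * D ^+ 2 / eps.
have XE : X = T%:R * Y.
  rewrite /X /Y /M div1r powR12_sqrt ?(ltW L0)// -/L2.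
  have -> : eps `^ (3 / 2) = eps * e2.
    rewrite (_ : 3 / 2 = 1 + 2^-1); last by field.
    rewrite powRD; last by rewrite (gt_eqF eps0) implybT.
    by rewrite powRr1 ?powR12_sqrt// ltW.
  by field; rewrite !gt_eqF.
have YE : Y = M * D ^+ 2 / eps by [].
clearbody Y M.
have Y1 : 1 <= Y by rewrite -(ler_pM2l TR) mulr1 -XE.
have YX : Y <= X by rewrite XE ler_peMl//; lra.
set u := expR 1; have u2 : 2 <= u by have := expR_ge1Dx (1 : R); rewrite -/u; lra.
have lnu : ln u = 1 by exact: expRK.
clearbody u.
pose l := ln (u + X); rewrite -/l.
have l1 : 1 <= l by rewrite -lnu ler_ln ?posrE; lra.
have Yl : ln Y <= l by rewrite ler_ln ?posrE; lra.
(* Large enough for [us] below, although [K], and hence [s], depends on [c1]. *)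
pose c1 := 16 * u ^+ 4.
have u4 : 1 <= u ^+ 4 by rewrite exprn_ege1//; lra.
have c16 : 16 <= c1 by rewrite /c1; lra.
have uc1 : u <= c1.
  have : u * 1 <= u * u ^+ 3 by rewrite ler_wpM2l ?exprn_ege1//; lra.
  rewrite -exprS /c1; lra.
have c1E : c1 = 16 * u ^+ 4 by [].
clearbody c1.
pose N := c1 * Y * l; have NE : N = c1 * Y * l by [].
have Yl1 : 1 <= Y * l by rewrite mulr_ege1.
have c1N : c1 <= N by rewrite /N -mulrA ler_peMr//; lra.
clearbody N l.
pose K := (Num.truncn N).+1.
have /andP[K2 NK] : (Num.truncn N)%:R <= N < K%:R by rewrite truncn_itv//; lra.
have K2N : K%:R <= 2 * N by rewrite /K -natr1; lra.
have K_gt0 : (0 < K)%N by [].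
have K0 : 0 < K%:R :> R by rewrite ltr0n.
clearbody K.
have lnK1 : 1 <= ln K%:R :> R by rewrite -[leLHS]lnu ler_ln ?posrE; lra.
have lnKle : ln K%:R <= (2 * c1 + 2) * l.
  have h1 : ln K%:R <= ln (2 * c1 * Y * l).
    have -> : 2 * c1 * Y * l = 2 * N by rewrite NE !mulrA.
    by rewrite ler_ln ?posrE; lra.
  have h5 : ln (2 * c1 * Y * l) = ln (2 * c1) + ln Y + ln l.
    by rewrite (@lnM _ (2 * c1 * Y)) ?(@lnM _ (2 * c1)) ?posrE ?mulr_gt0//; lra.
  have h2 : ln (2 * c1) < 2 * c1 by apply: ln_sublinear; lra.
  have h3 : ln l < l by apply: ln_sublinear; lra.
  have h6 : 2 * c1 <= 2 * c1 * l by rewrite ler_peMr//; lra.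
  lra.
pose s := Num.sqrt (ln (K%:R : R)).
have sE : s ^+ 2 = ln K%:R by rewrite sqr_sqrtr//; lra.
have s0 : 0 < s by rewrite sqrtr_gt0; lra.
(* With [N < K], this is what the distance term needs to stay below [eps / 2]. *)
have us : 2 * u ^+ 2 * s <= c1 * l.
  rewrite -(@ler_pXn2r _ 2)// ?nnegrE ?mulr_ge0 ?sqr_ge0//; try lra.
  rewrite 2!exprMn sE -exprM exprMn.
  have h1 : 4 * u ^+ 4 * ln K%:R <= 4 * u ^+ 4 * ((2 * c1 + 2) * l).
    by rewrite ler_pM2l//; lra.
  have h2 : 4 * u ^+ 4 * (2 * c1 + 2) <= c1 ^+ 2.
    have -> : 4 * u ^+ 4 = c1 / 4 by rewrite c1E; field.
    rewrite expr2 -mulrA ler_pM2l; lra.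
  have h3 : c1 ^+ 2 * l <= c1 ^+ 2 * l ^+ 2.
    by rewrite ler_wpM2l ?sqr_ge0// expr2 ler_peMr//; lra.
  have h4 := @ler_wpM2r _ l (le_trans ler01 l1) _ _ h2.
  lra.
(* [2 * s] is the square root of beta; the factor [u] absorbs the later bound [u] on the power of
   [K] in the noise term. *)
pose eta := (2 * s * u * M * T%:R)^-1.
have u0 : 0 < u by lra.
have eta0 : 0 < eta by rewrite invr_gt0 !mulr_gt0.
have etaT : eta * T%:R = (2 * s * u * M)^-1.
  by rewrite /eta; field; rewrite !gt_eqF.
have sqrt4 : Num.sqrt (4 * ln (K%:R : R)) = 2 * s.
  rewrite sqrtrM// -/s (_ : 4 = 2 ^+ 2); last by ring.
  by rewrite sqrtr_sqr ger0_norm.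
have etale : eta <= 1 / (Num.sqrt (4 * ln K%:R) * T%:R * L).
  rewrite sqrt4 div1r lef_pV2 ?posrE ?mulr_gt0//.
  have -> : 2 * s * u * M * T%:R = 2 * s * T%:R * (u * M) by ring.
  rewrite ler_pM2l ?mulr_gt0//.
  by apply: le_trans LM _; rewrite ler_peMl ?ltW//; lra.
exists K, eta; split => //; last first.
  rewrite natrM XE.
  have -> : 32 * u ^+ 4 * (T%:R * Y) * l = T%:R * (2 * N) by rewrite NE c1E; ring.
  by rewrite ler_pM2l.
have lnK0 : 0 < ln (K%:R : R) by lra.
have ab : 4^-1 + (4 * ln (K%:R : R))^-1 <= 1 / 2.
  have : (4 * ln (K%:R : R))^-1 <= 4^-1 by rewrite lef_pV2 ?posrE//; lra.
  lra.
have b0 : 0 < 4 * ln (K%:R : R) by lra.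
have := @igd_last_iterate_le R d T L f x0 xs 4 (4 * ln K%:R) eta K
  T0 L0 cf sf xmin ltac:(by []) b0 ab eta0 etale K_gt0.
set a := (1 + 4 / _)^-1.
(* The exponent is 1 / (1 + ln K), so the logarithm of the power is below 1. *)
have Ka : K%:R `^ (1 - a) <= u.
  have -> : 1 - a = (1 + ln K%:R)^-1.
    by rewrite /a; field; rewrite !gt_eqF//; lra.
  rewrite -ler_ln ?posrE ?powR_gt0// ln_powR lnu mulrC ler_pdivrMr; lra.
have Kma : K%:R `^ (- a) <= u / K%:R.
  rewrite ler_pdivlMr// -[X in _ * X](powRr1 (ltW K0)) -powRD; last first.
    by rewrite (gt_eqF K0) implybT.
  by rewrite addrC.
have -> : 1 + 4 * ln K%:R / 4 = 1 + s ^+ 2 by rewrite sE; field.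
have -> : eta ^+ 2 * T%:R ^+ 2 * grad_var f xs * L = (eta * T%:R) ^+ 2 * (L * sigma ^+ 2).
  by rewrite sigE; ring.
rewrite -/D -[2 * eta * _]mulrA etaT => /le_trans; apply.
have s21 : 1 <= s ^+ 2 by rewrite sE.
have p1 : (2 * s * u * M)^-1 ^+ 2 * (L * sigma ^+ 2) * (1 + s ^+ 2) * K%:R `^ (1 - a)
    <= eps / 2.
  apply: (@le_trans _ _ ((2 * s * u * M)^-1 ^+ 2 * (M ^+ 2 * eps) * (2 * s ^+ 2) * u)).
    have q0 : 0 <= (2 * s * u * M)^-1 ^+ 2 by rewrite sqr_ge0.
    have Ls0 : 0 <= L * sigma ^+ 2 by rewrite mulr_ge0 ?sqr_ge0// ltW.
    have s2 : 1 + s ^+ 2 <= 2 * s ^+ 2 by lra.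
    have s3 : 0 <= 1 + s ^+ 2 by lra.
    apply: ler_pM => //; first by rewrite mulr_ge0// mulr_ge0.
    by apply: ler_pM => //; [rewrite mulr_ge0 | rewrite ler_wpM2l].
  have -> : (2 * s * u * M)^-1 ^+ 2 * (M ^+ 2 * eps) * (2 * s ^+ 2) * u = eps / 2 / u.
    by field; rewrite !gt_eqF.
  rewrite ler_pdivrMr// ler_peMr//; lra.
have p2 : (2 * (2 * s * u * M)^-1)^-1 * D ^+ 2 * K%:R `^ (- a) <= eps / 2.
  apply: (@le_trans _ _ ((2 * (2 * s * u * M)^-1)^-1 * D ^+ 2 * (u / K%:R))).
    by rewrite ler_wpM2l// mulr_ge0 ?sqr_ge0// invr_ge0 !mulr_ge0// ltW// invr_gt0 !mulr_gt0.
  have -> : (2 * (2 * s * u * M)^-1)^-1 * D ^+ 2 * (u / K%:R) =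
     (2 * u ^+ 2 * s) * Y * (eps / 2) / K%:R.
    by rewrite YE; field; rewrite !gt_eqF.
  rewrite ler_pdivrMr// [eps / 2 * _]mulrC ler_pM2r; last by rewrite divr_gt0.
  apply: le_trans (ltW NK); rewrite NE [leRHS]mulrAC ler_pM2r//; lra.
lra.
Qed.

(** * Last-iterate bound in its stated form, and the evaluation count *)

Theorem theorem2p3 (R : realType) :
  (forall (d T : nat) (L : R) (f : 'I_T -> 'rV[R]_d -> R)
      (x0 xstar : 'rV[R]_d) (alpha beta eta : R) (K : nat),
    (0 < T)%N -> 0 < L ->
    (forall t, convex_function [set: 'rV[R]_d] (f t)) ->
    (forall t, smooth L (f t)) ->
    is_minimizer (avg_fun f) xstar ->
    0 < alpha -> 0 < beta -> alpha^-1 + beta^-1 <= 1 / 2 ->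
    0 < eta -> eta <= 1 / (Num.sqrt beta * T%:R * L) ->
    (0 < K)%N ->
    avg_fun f (igd f (fun=> eta) x0 K) - avg_fun f xstar <=
      expR 1 * eta ^+ 2 * T%:R ^+ 2 * grad_var f xstar * L *
        (1 + beta / alpha) *
        K%:R `^ ((alpha / beta) / (1 + alpha / beta)) +
      expR 1 * enorm (x0 - xstar) ^+ 2 /
        (2 * eta * T%:R * K%:R `^ (1 / (1 + alpha / beta)))) /\
  (exists C p : R, [/\ 0 < C, 0 < p &
    forall (d T : nat) (L : R) (f : 'I_T -> 'rV[R]_d -> R)
      (x0 xstar : 'rV[R]_d) (eps : R),
    (0 < T)%N -> 0 < L ->
    (forall t, convex_function [set: 'rV[R]_d] (f t)) ->
    (forall t, smooth L (f t)) ->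
    is_minimizer (avg_fun f) xstar ->
    0 < eps ->
    let D := enorm (x0 - xstar) in
    let sigma := Num.sqrt (grad_var f xstar) in
    let X := T%:R * L * D ^+ 2 / eps +
             T%:R * L `^ (1 / 2) * sigma * D ^+ 2 / eps `^ (3 / 2) in
    T%:R <= X ->
    exists (K : nat) (eta : R),
      [/\ 1 <= ln (K%:R : R),
          0 < eta,
          eta <= 1 / (Num.sqrt (4 * ln K%:R) * T%:R * L),
          avg_fun f (igd f (fun=> eta) x0 K) - avg_fun f xstar <= eps &
          (T * K)%:R <= C * X * ln (expR 1 + X) `^ p]]).
Proof.
split.
  move=> d T L f x0 xs alpha beta eta K T0 L0 cf sf xmin a0 b0 ab e0 eb K0.
  apply: le_trans (igd_last_iterate_le x0 T0 L0 cf sf xmin a0 b0 ab e0 eb K0) _.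
  have c0 : 0 < alpha / beta by rewrite divr_gt0.
  have TR : 0 < T%:R :> R by rewrite ltr0n.
  have KR : 0 < K%:R :> R by rewrite ltr0n.
  have u1 : 1 <= expR 1 :> R by have := expR_ge1Dx (1 : R); lra.
  have -> : 1 - (1 + alpha / beta)^-1 = alpha / beta / (1 + alpha / beta).
    by field; rewrite !gt_eqF//= addr_gt0.
  rewrite powRN div1r; apply: lerD.
    have g0 : 0 <= eta ^+ 2 * T%:R ^+ 2 * grad_var f xs * L * (1 + beta / alpha).
      apply: mulr_ge0; last by rewrite addr_ge0// divr_ge0// ltW.
      apply: mulr_ge0 (ltW L0); apply: mulr_ge0 (grad_var_ge0 f xs).
      exact: mulr_ge0 (sqr_ge0 _) (sqr_ge0 _).
    by rewrite ler_wpM2r ?powR_ge0// -!(mulrA (expR 1)) ler_peMl.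
  rewrite [in leRHS]invfM -[leRHS]mulrA [enorm _ ^+ 2 * (_ / _)]mulrA [enorm _ ^+ 2 * _]mulrC.
  by rewrite ler_peMl// divr_ge0 ?powR_ge0// mulr_ge0 ?sqr_ge0// invr_ge0 ltW// !mulr_gt0.
(* Twice the constant [c1], since K is at most [2 * N]; the logarithm enters to the first power. *)
exists (32 * expR 1 ^+ 4), 1; split => //.
move=> d T L f x0 xs eps T0 L0 cf sf xmin eps0 D sigma X TX.
have [K [eta [h1 h2 h3 h4 h5]]] := igd_complexity T0 L0 cf sf xmin eps0 TX.
exists K, eta; split => //; rewrite powRr1// ln_ge0//.
have : 0 <= X by apply: le_trans TX; rewrite ler0n.
by have := expR_ge1Dx (1 : R); lra.
Qed.
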